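(* Let $n\ge 2$ and let $\mathcal{M}\subseteq\mathbb{R}^{n\times n}$ be a finite set of matrices. If $\mathcal{M}$ contains at least one rank one singular matrix (i.e. a matrix whose image is one-dimensional), then $\tilde\rho(\mathcal{M})=\check\rho(\mathcal{M})$.
   Context: For a finite set $\mathcal{M}=\{M_1,\dots,M_m\}\subseteq\mathbb{R}^{n\times n}$, consider the discrete-time switched system $x(t+1)=M_{\sigma(t)}x(t)$, $x(0)=x_0\in\mathbb{R}^n$, where the switching law $\sigma(\cdot)$ takes values in $\{1,\dots,m\}$ and may depend on $x_0$. The stabilizability radius is $$\tilde\rho(\mathcal{M})=\sup_{x_0\in\mathbb{R}^n}\inf\{\lambda\ge 0 \mid \exists\,\sigma(\cdot),\ c>0 \text{ such that } \|x(t)\|\le c\lambda^t\|x_0\|\ \ \forall t\ge 0\}.$$ Let $\mathcal{M}^T$ be the set of all products $M_{\sigma(T)}\cdots M_{\sigma(1)}$ of length $T$ of matrices from $\mathcal{M}$. The joint spectral subradius is $\check\rho(\mathcal{M})=\lim_{T\to\infty}\inf_{A\in\mathcal{M}^T}\|A\|^{1/T}$ (independent of the norm). Standing convention: only finite matrix sets are considered. *)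

(* Defs.v *)
From mathcomp Require Import all_boot all_order all_algebra.
From mathcomp Require Import all_classical all_reals all_analysis.
Import Order.TTheory GRing.Theory Num.Theory.
Import numFieldNormedType.Exports.

Set Implicit Arguments.
Unset Strict Implicit.
Unset Printing Implicit Defensive.

Local Open Scope classical_set_scope.
Local Open Scope ring_scope.

(* The library's norm on matrices is one particular (entrywise max) norm; this
   predicate allows quantification over all norms on a real vector space. *)
Definition is_norm (R : realType) (V : lmodType R) (N : V -> R) : Prop :=
  [/\ forall x, N x = 0 -> x = 0,
      forall (a : R) x, N (a *: x) = `|a| * N x
    & forall x y, N (x + y) <= N x + N y].

Fixpoint trajectory (R : realType) (n m : nat) (M : 'I_m -> 'M[R]_n)
    (sigma : nat -> 'I_m) (x0 : 'cV[R]_n) (t : nat) : 'cV[R]_n :=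
  if t is t'.+1 then M (sigma t') *m trajectory M sigma x0 t' else x0.

(* sup and inf are the real-valued ones. Since sigma and c are chosen after x0,
   both may depend on the initial state. *)
Definition stabilizability_radius (R : realType) (n m : nat)
    (N : 'cV[R]_n -> R) (M : 'I_m -> 'M[R]_n) : R :=
  sup [set inf [set lambda : R | 0 <= lambda /\
         exists (sigma : nat -> 'I_m) (c : R), 0 < c /\
           forall t, N (trajectory M sigma x0 t) <= c * lambda ^+ t * N x0]
      | x0 in [set: 'cV[R]_n]].

(* s = (sigma(1), ..., sigma(T)); the reversal puts M_{sigma(T)} leftmost. *)
Definition products (R : realType) (n m : nat) (M : 'I_m -> 'M[R]_n)
    (T : nat) : set 'M[R]_n :=
  [set \prod_(i <- rev s) M i | s in [set: T.-tuple 'I_m]].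

Definition joint_spectral_subradius (R : realType) (n m : nat)
    (N : 'M[R]_n -> R) (M : 'I_m -> 'M[R]_n) : R :=
  lim ((fun T : nat => inf [set N A `^ (T%:R)^-1 | A in products M T]) @ \oo).

(* Main.v *)
(* A product A of length T gives, by periodic switching, a trajectory from every
   x0 of rate (K |A|)^(1/T), where K makes the norm submultiplicative; hence
   K^(-1/T) rho~ <= min_A |A|^(1/T).  Conversely write the rank one matrix as
   u v^T: a switching law that is good for the single initial state u, with
   products P_t, satisfies |P_t u v^T| <= C lam^t, and P_t u v^T is a product of
   length t + 1.  Both bounds tend to rho~ as T grows. *)
Require Import Defs.
From mathcomp Require Import all_boot all_order all_algebra.
From mathcomp Require Import all_classical all_reals all_analysis.
Import Order.TTheory GRing.Theory Num.Theory.
Import numFieldNormedType.Exports.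

Local Open Scope classical_set_scope.
Local Open Scope ring_scope.

(** * Norms on finite-dimensional matrix spaces and their equivalence *)

Section Norms.
Context {R : realType}.

Lemma is_norm0 {V : lmodType R} {N : V -> R} : is_norm N -> N 0 = 0.
Proof. by case=> _ NZ _; rewrite -(scale0r 0) NZ normr0 mul0r. Qed.

Lemma is_normN {V : lmodType R} {N : V -> R} x : is_norm N -> N (- x) = N x.
Proof. by case=> _ NZ _; rewrite -scaleN1r NZ normrN1 mul1r. Qed.

Lemma is_norm_ge0 {V : lmodType R} {N : V -> R} x : is_norm N -> 0 <= N x.
Proof.
move=> hN; have [_ _ ND] := hN.
have := ND x (- x); rewrite subrr (is_norm0 hN) (is_normN _ hN) -mulr2n.
by rewrite pmulrn_lge0.
Qed.

Lemma is_norm_sum {V : lmodType R} {N : V -> R} (I : finType) (F : I -> V) :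
  is_norm N -> N (\sum_i F i) <= \sum_i N (F i).
Proof.
move=> hN; have [_ _ ND] := hN.
elim/big_ind2 : _ => // [|x a y b xa yb]; first by rewrite (is_norm0 hN).
by rewrite (le_trans (ND _ _))// lerD.
Qed.

Lemma is_norm_mx_norm (a b : nat) :
  is_norm (fun A : 'M[R]_(a, b) => `|A|).
Proof.
by split=> [A /normr0_eq0 //|c A|A B]; [rewrite normrZ|exact: ler_normD].
Qed.

Lemma mx_entry_le_norm {a b : nat} (A : 'M[R]_(a, b)) i j : `|A i j| <= `|A|.
Proof.
rewrite [leRHS]/Num.Def.normr/= mx_normrE.
exact: (le_bigmax _ (fun ij : 'I_a * 'I_b => `|A ij.1 ij.2|) (i, j)).
Qed.

(** Expand [A] in the basis [delta_mx i j] and apply the triangle inequality. The summand 1 in the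
    constant only makes it positive. *)
Lemma is_norm_le_mx_norm {a b : nat} {N : 'M[R]_(a, b) -> R} :
  is_norm N -> exists2 C : R, 0 < C & forall A, N A <= C * `|A|.
Proof.
move=> hN; have [_ NZ _] := hN.
exists (1 + \sum_i \sum_j N (delta_mx i j)).
  rewrite ltr_pwDl// sumr_ge0// => i _; rewrite sumr_ge0// => j _.
  exact: is_norm_ge0.
move=> A; rewrite {1}(matrix_sum_delta A) mulrDl mul1r ler_wpDl//.
rewrite mulr_suml (le_trans (is_norm_sum _ _ hN))// ler_sum// => i _.
rewrite mulr_suml (le_trans (is_norm_sum _ _ hN))// ler_sum// => j _.
by rewrite NZ mulrC ler_wpM2l ?mx_entry_le_norm// is_norm_ge0.
Qed.

(** By the reverse triangle inequality, [N] is Lipschitz for the entrywise max norm. *)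
Lemma is_norm_continuous {a b : nat} {N : 'M[R]_(a, b) -> R} :
  is_norm N -> continuous N.
Proof.
move=> hN x; have [_ _ ND] := hN.
have [C C0 NC] := is_norm_le_mx_norm hN.
have dN y z : N y - N z <= C * `|z - y|.
  rewrite lerBlDr -{1}(subrK z y) (le_trans (ND _ _))// lerD2r.
  by rewrite -normrN opprB.
apply/(@cvgrPdist_lt _ _ _ (nbhs x)) => e e0; near=> y.
apply: (@le_lt_trans _ _ (C * `|x - y|)).
  by rewrite ler_norml lerNl opprB dN/= distrC dN.
rewrite -ltr_pdivlMl//; near: y.
by apply: cvgr_dist_lt => //; rewrite mulr_gt0 ?invr_gt0.
Unshelve. all: by end_near. Qed.

(* N attains a positive minimum on the compact unit sphere. *)
Lemma rV_norm_le_is_norm {k : nat} {N : 'rV[R]_k -> R} :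
  is_norm N -> exists2 C : R, 0 < C & forall x, `|x| <= C * N x.
Proof.
move=> hN; have [N0 NZ _] := hN.
pose S := [set x : 'rV[R]_k | `|x| = 1].
have sphere (x : 'rV[R]_k) : x != 0 -> S (`|x|^-1 *: x).
  by move=> x0; rewrite /S/= normrZ normrV ?unitfE ?normr_eq0// normr_id mulVf ?normr_eq0.
(* An empty sphere has no minimum, but then every vector is 0 and any constant works. *)
have [Sn0|S0] := pselect (S !=set0); last first.
  exists 1 => // x; rewrite mul1r.
  have [->|/sphere Sx] := eqVneq x 0; first by rewrite normr0 is_norm_ge0.
  by exfalso; apply: S0; eexists; exact: Sx.
have Sc : compact S.
  apply: bounded_closed_compact.
    exists 1; split => // e e1 x /= ->; exact: ltW.
  rewrite (_ : S = (fun x : 'rV[R]_k => `|x|) @^-1` [set 1])//.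
  by apply: preimage_closed; [move=> x _; exact: norm_continuous|exact: closed_eq].
have [c /set_mem Sc1 cmin] := compact_EVT_min Sn0 Sc
  (continuous_subspaceT (is_norm_continuous hN)).
have Nc0 : 0 < N c.
  rewrite lt_def is_norm_ge0// andbT; apply/eqP => /N0 c0.
  by move: Sc1; rewrite /S/= c0 normr0 => /eqP; rewrite eq_sym oner_eq0.
exists (N c)^-1; first by rewrite invr_gt0.
move=> x; have [->|x0] := eqVneq x 0.
  by rewrite normr0 mulr_ge0 ?invr_ge0 ?is_norm_ge0.
have /cmin := mem_set (sphere _ x0).
rewrite NZ normrV ?unitfE ?normr_eq0// normr_id => h.
by rewrite ler_pdivlMl// -ler_pdivlMr ?normr_gt0// mulrC.
Qed.

(** The compactness bound concerns row vectors; [vec_mx] transports it to matrices. *)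
Lemma entry_le_is_norm {a b : nat} {N : 'M[R]_(a, b) -> R} :
  is_norm N -> exists2 C : R, 0 < C &
    forall (A : 'M[R]_(a, b)) i j, `|A i j| <= C * N A.
Proof.
move=> [N0 NZ ND].
have hN : is_norm (fun x : 'rV[R]_(a * b) => N (vec_mx x)).
  split=> [x /N0 x0|c x|x y]; last 2 first.
  - by rewrite linearZ/= NZ.
  - by rewrite linearD/= ND.
  by rewrite -[x]vec_mxK x0 linear0.
have [C C0 NC] := rV_norm_le_is_norm hN.
exists C => // A i j; rewrite -mxvecE -{2}(mxvecK A).
exact: le_trans (mx_entry_le_norm _ _ _) (NC _).
Qed.

(** Substitute for submultiplicativity, which [is_norm] does not grant. Three separate norms let it
    serve matrix times matrix, matrix times state and column times row. Each entry of [A *m B] is a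
    sum of [b] terms, whence the factor [b%:R]. *)
Lemma mulmx_norm_bound {a b c : nat} {N1 : 'M[R]_(a, b) -> R}
    {N2 : 'M[R]_(b, c) -> R} {N3 : 'M[R]_(a, c) -> R} :
  is_norm N1 -> is_norm N2 -> is_norm N3 ->
  exists2 K : R, 0 < K & forall A B, N3 (A *m B) <= K * N1 A * N2 B.
Proof.
move=> h1 h2 h3.
have [C1 C10 NC1] := entry_le_is_norm h1.
have [C2 C20 NC2] := entry_le_is_norm h2.
have [C3 C30 NC3] := is_norm_le_mx_norm h3.
exists (C3 * (1 + b%:R * (C1 * C2))).
  by rewrite mulr_gt0// ltr_pwDl// mulr_ge0// mulr_ge0// ltW.
move=> A B; rewrite (le_trans (NC3 _))// -!mulrA ler_pM2l//.
rewrite mulrDl mul1r ler_wpDl ?mulr_ge0 ?is_norm_ge0//.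
rewrite [leLHS]/Num.Def.normr/= mx_normrE bigmax_le//.
  by rewrite !mulr_ge0 ?(is_norm_ge0 _ h1) ?(is_norm_ge0 _ h2) ?ler0n ?(ltW C10) ?(ltW C20).
move=> [i j] _ /=; rewrite mxE (le_trans (ler_norm_sum _ _ _))//.
rewrite (@le_trans _ _ (\sum_(k < b) C1 * C2 * (N1 A * N2 B)))//.
  apply: ler_sum => k _; rewrite normrM mulrACA.
  by rewrite ler_pM.
by rewrite sumr_const card_ord -[b%:R * _ * _]mulrA mulr_natl.
Qed.

End Norms.

(** * Geometric growth and roots of constants *)

Lemma geometric_bound {R : realType} {a : nat -> R} {T : nat} {lam : R} :
  (0 < T)%N -> 0 < lam -> (forall t, 0 <= a t) ->
  (forall t, a (t + T)%N <= lam ^+ T * a t) ->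
  exists2 c : R, 0 < c & forall t, a t <= c * lam ^+ t.
Proof.
move=> T0 lam0 a0 aT.
have q0 t : 0 <= a t / lam ^+ t by rewrite divr_ge0// exprn_ge0// ltW.
(* The sum dominates the ratios [a r / lam ^+ r] of the first [T] terms, and a shift by [T] never
   increases the ratio. *)
exists (1 + \sum_(r < T) a r / lam ^+ r); first by rewrite ltr_pwDl// sumr_ge0.
move=> t; elim/ltn_ind: t => t IH; have [tT|Tt] := ltnP t T.
  rewrite -ler_pdivrMr ?exprn_gt0// (bigD1 (Ordinal tT))//= addrCA lerDl.
  by rewrite addr_ge0// sumr_ge0.
rewrite -(subnK Tt) (le_trans (aT _))// exprD [lam ^+ _ * lam ^+ T]mulrC mulrCA.
by rewrite ler_pM2l ?exprn_gt0// IH// ltn_subrL T0 (leq_trans T0).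
Qed.

Lemma powR_invnK {R : realType} {x : R} {T : nat} :
  (0 < T)%N -> 0 <= x -> (x `^ (T%:R)^-1) ^+ T = x.
Proof.
move=> T0 x0; rewrite -powR_mulrn ?powR_ge0// -powRrM mulVf ?powRr1//.
by rewrite pnatr_eq0 -lt0n.
Qed.

(** Rewritten as [expR (ln K / T)]. This is what makes norm-dependent constants disappear in the
    limit. *)
Lemma cvg_powR_invn {R : realType} {K : R} :
  0 < K -> (K `^ (T%:R)^-1) @[T --> \oo] --> (1 : R).
Proof.
move=> K0.
have -> : (fun T : nat => K `^ (T%:R)^-1) = (fun T => expR ((T%:R)^-1 * ln K)).
  by apply/funext => T; rewrite /powR gt_eqF.
rewrite -[X in _ --> X]expR0; apply: continuous_cvg; first exact: continuous_expR.
rewrite -[X in _ --> X](mul0r (ln K)); apply: cvgMl.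
apply/gtr0_cvgV0; last exact: cvgr_idn.
by near=> T; rewrite ltr0n; near: T; exact: nbhs_infty_gt.
Unshelve. all: by end_near. Qed.

(** * Products along switching laws and the rates they allow *)

Section SwitchedSystem.
Context {R : realType} {n m : nat} (M : 'I_m -> 'M[R]_n).

Definition switching_product (sigma : nat -> 'I_m) (t : nat) : 'M[R]_n :=
  \prod_(i <- rev (mkseq sigma t)) M i.

Lemma switching_product0 sigma : switching_product sigma 0 = 1.
Proof. by rewrite /switching_product big_nil. Qed.

Lemma switching_productS sigma t :
  switching_product sigma t.+1 = M (sigma t) * switching_product sigma t.
Proof. by rewrite /switching_product mkseqS rev_rcons big_cons. Qed.

Lemma switching_productD sigma t T :
  switching_product sigma (t + T) =
  switching_product (fun s => sigma (s + T)%N) t * switching_product sigma T.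
Proof.
elim: t => [|t IH]; first by rewrite switching_product0 mul1r.
by rewrite addSn !switching_productS IH mulrA.
Qed.

Lemma trajectoryE sigma x t :
  trajectory M sigma x t = switching_product sigma t *m x.
Proof.
elim: t => [|t IH]; first by rewrite switching_product0 mul1mx.
by rewrite switching_productS /= IH mulmxA.
Qed.

Lemma products_switching_product sigma t :
  products M t (switching_product sigma t).
Proof.
have sz : size (mkseq sigma t) == t by rewrite size_mkseq.
by exists (Tuple sz).
Qed.

(** The rightmost factor acts first, so [i] is put at the head of the word. *)
Lemma products_switching_productM sigma t i :
  products M t.+1 (switching_product sigma t * M i).
Proof.
have sz : size (i :: mkseq sigma t) == t.+1 by rewrite /= size_mkseq.
exists (Tuple sz) => //=.
by rewrite rev_cons big_rcons.
Qed.

Lemma products_periodic T A : (0 < T)%N -> products M T A ->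
  exists2 sigma, (fun t => sigma (t + T)%N) = sigma &
    switching_product sigma T = A.
Proof.
(* The default for [nth] comes from [s] itself, as ['I_m] has no canonical element. *)
move=> T0 [s _ <-]; pose i0 := tnth s (Ordinal T0).
exists (fun t => nth i0 s (t %% T)); first by apply/funext => t; rewrite modnDr.
rewrite /switching_product; congr (\prod_(i <- rev _) M i).
rewrite -[RHS](mkseq_nth i0) size_tuple; apply/eq_in_map => t.
by rewrite mem_iota => /andP[_ tT]; rewrite modn_small.
Qed.

Context {normv : 'cV[R]_n -> R} {normm : 'M[R]_n -> R}.
Hypotheses (hnormv : is_norm normv) (hnormm : is_norm normm).

(** Copies the set inside [stabilizability_radius], so that the two agree by conversion. *)
Definition admissible_rates (x0 : 'cV[R]_n) : set R :=
  [set lambda : R | 0 <= lambda /\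
         exists (sigma : nat -> 'I_m) (c : R), 0 < c /\
           forall t, normv (trajectory M sigma x0 t) <= c * lambda ^+ t * normv x0].

Lemma admissible_rates_lbound x0 : has_lbound (admissible_rates x0).
Proof. by exists 0 => y []. Qed.

(** Under periodic repetition of [A], each period multiplies the norm bound by at most
    [K * normm A]. The constant [K] is uniform in [T] and [A], so its [T]-th root tends to 1. *)
Lemma product_rate_admissible : exists2 K : R, 0 < K &
  forall T A, (0 < T)%N -> products M T A ->
  forall lam : R, 0 < lam -> K * normm A <= lam ^+ T ->
  forall x0, admissible_rates x0 lam.
Proof.
have [K K0 NK] := mulmx_norm_bound hnormm hnormm hnormm.
have [K' K'0 NK'] := mulmx_norm_bound hnormm hnormv hnormv.
exists K => // T A T0 MA lam lam0 Alam x0.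
have [sigma sigmaT sA] := products_periodic _ _ T0 MA.
have [c c0 Hc] : exists2 c : R, 0 < c &
    forall t, normm (switching_product sigma t) <= c * lam ^+ t.
  apply: (geometric_bound T0 lam0) => [t|t]; first exact: is_norm_ge0.
  rewrite switching_productD sigmaT sA (le_trans (NK _ _))//.
  by rewrite mulrAC ler_wpM2r// is_norm_ge0.
split; first exact: ltW.
exists sigma, (K' * c); split; first exact: mulr_gt0.
move=> t; rewrite trajectoryE (le_trans (NK' _ _))// ler_wpM2r ?is_norm_ge0//.
by rewrite -mulrA ler_pM2l.
Qed.

(** Constant switching to [i] supplies a rate; this keeps [inf] from being that of an empty set. *)
Lemma admissible_rates_neq0 (i : 'I_m) x0 : admissible_rates x0 !=set0.
Proof.
have [K K0 NK] := product_rate_admissible.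
have P1 := products_switching_product (fun=> i) 1.
exists (1 + K * normm (switching_product (fun=> i) 1)).
apply: (NK _ _ _ P1) => //; last by rewrite expr1 lerDr.
by rewrite ltr_pwDl// mulr_ge0 ?is_norm_ge0// ltW.
Qed.

Lemma rank1_product_bound i : \rank (M i) = 1%N ->
  exists x0, forall lam, 0 < lam -> inf (admissible_rates x0) < lam ->
    exists2 C : R, 0 < C & forall t, exists2 A, products M t.+1 A &
      normm A <= C * lam ^+ t.
Proof.
move=> rk; have := mulmx_base (M i).
(* Rank one turns the base factorization into [M i = u *m v] with a column [u] and a row [v]; [u] is
   the initial state, fixed before [lam]. *)
move: (col_base _) (row_base _); rewrite rk => u v uv.
have [K K0 NK] := mulmx_norm_bound hnormv (is_norm_mx_norm 1 n) hnormm.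
exists u => lam lam0.
move=> /(inf_lt (admissible_rates_neq0 i u))[mu [mu0 [sigma [c [c0 Hc]]]] mulam].
exists (1 + K * c * normv u * `|v|).
  by rewrite ltr_pwDl// !mulr_ge0 ?(is_norm_ge0 _ hnormv) ?(ltW K0) ?(ltW c0).
move=> t; exists (switching_product sigma t * M i).
  exact: products_switching_productM.
rewrite -uv [_ * _]mulmxA -trajectoryE (le_trans (NK _ _))//.
rewrite mulrDl mul1r ler_wpDl//; first by rewrite exprn_ge0// ltW.
rewrite [leRHS]mulrAC ler_wpM2r// -!mulrA ler_pM2l//.
rewrite (le_trans (Hc _))// -mulrA ler_pM2l// mulrC.
by rewrite ler_wpM2l ?is_norm_ge0// lerXn2r ?nnegrE// ltW.
Qed.

End SwitchedSystem.

(** * Squeezing the infima over products of length [T] *)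

Theorem proposition3p1 (R : realType) (n m : nat) (M : 'I_m -> 'M[R]_n)
    (normv : 'cV[R]_n -> R) (normm : 'M[R]_n -> R)
    (hn : (2 <= n)%N) (hnormv : is_norm normv) (hnormm : is_norm normm)
    (hrank1 : exists i : 'I_m, \rank (M i) = 1%N) :
  stabilizability_radius normv M = joint_spectral_subradius normm M.
Proof.
case: hrank1 => i rk; have [u Hu] := rank1_product_bound M hnormv hnormm i rk.
have [K K0 NK] := product_rate_admissible M hnormv hnormm.
set rho := stabilizability_radius normv M.
pose a (T : nat) : set R := [set normm A `^ (T%:R)^-1 | A in products M T].
have a_neq0 T : a T !=set0.
  by eexists; exists (switching_product M (fun=> i) T) => //;
     exact: products_switching_product.
have a_lb T : has_lbound (a T) by exists 0 => _ [A _ <-]; exact: powR_ge0.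
pose E : set R :=
  [set inf (admissible_rates M (normv := normv) x0) | x0 in [set: 'cV[R]_n]].
have rhoE : rho = sup E by [].
have E_ub T A lam : (0 < T)%N -> products M T A -> 0 < lam ->
    K * normm A <= lam ^+ T -> ubound E lam.
  move=> T0 MA lam0 Alam _ [x0 _ <-].
  by apply: ge_inf; [exact: admissible_rates_lbound|exact: NK MA _ _ _ _].
have E_hub : has_ubound E.
  have P1 := products_switching_product M (fun=> i) 1.
  exists (1 + K * normm (switching_product M (fun=> i) 1)).
  apply: (E_ub _ _ _ _ P1) => //; last by rewrite expr1 lerDr.
  by rewrite ltr_pwDl// mulr_ge0 ?is_norm_ge0// ltW.
have inf_le_rho x0 : inf (admissible_rates M (normv := normv) x0) <= rho.
  by rewrite rhoE; apply: ub_le_sup => //; exists x0.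
have rho_le T A : (0 < T)%N -> products M T A -> rho <= (K * normm A) `^ (T%:R)^-1.
  (* The slack [e] keeps the rate positive even when [A] is zero. *)
  move=> T0 MA; apply/ler_addgt0Pr => e e0; rewrite rhoE.
  apply: ge_sup; first by exists (inf (admissible_rates M (normv := normv) u)), u.
  apply: (E_ub _ _ _ T0 MA); first by rewrite ltr_wpDl// powR_ge0.
  have KA0 : 0 <= K * normm A by rewrite mulr_ge0 ?is_norm_ge0// ltW.
  rewrite -{1}(powR_invnK T0 KA0).
  by rewrite lerXn2r ?nnegrE ?addr_ge0 ?powR_ge0 ?(ltW e0)// lerDl (ltW e0).
have rho0 : 0 <= rho.
  apply: le_trans (inf_le_rho u); apply: lb_le_inf; last by move=> y [].
  exact: admissible_rates_neq0 hnormv hnormm i u.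
apply/esym; rewrite /joint_spectral_subradius; apply: cvg_lim => //.
apply/cvgrPdist_lt => e e0.
have e20 : 0 < e / 2 by rewrite divr_gt0.
(* [lam] lies strictly above [rho], as the infimum at [u] need not be attained; the other half of
   [e] absorbs the convergence to [lam]. *)
pose lam := rho + e / 2; have lam0 : 0 < lam by rewrite ltr_wpDl.
have [|C C0 HC] := Hu lam lam0.
  by rewrite (le_lt_trans (inf_le_rho u))// ltrDl.
have lower : (rho / K `^ (T%:R)^-1) @[T --> \oo] --> rho.
  rewrite -[X in _ --> X]mulr1 -[X in _ * X]invr1; apply: cvgMr.
  by apply: cvgV; [exact: oner_neq0|exact: cvg_powR_invn].
(* This is the [T]-th root of [C * lam ^+ T.-1] for positive [T]: the extra factor [M i] makes the
   length exceed the exponent by one, whence [C / lam]. *)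
have upper : ((C / lam) `^ (T%:R)^-1 * lam) @[T --> \oo] --> lam.
  rewrite -[X in _ --> X]mul1r; apply: cvgMl.
  by apply: cvg_powR_invn; rewrite divr_gt0.
have lo T : (0 < T)%N -> rho / K `^ (T%:R)^-1 <= inf (a T).
  move=> T0; apply: lb_le_inf => // _ [A MA <-].
  rewrite ler_pdivrMr ?powR_gt0// mulrC -powRM ?is_norm_ge0 ?(ltW K0)//.
  exact: rho_le.
have up T : (0 < T)%N -> inf (a T) <= (C / lam) `^ (T%:R)^-1 * lam.
  case: T => // T _.
  have [A MA NA] := HC T.
  apply: (@le_trans _ _ (normm A `^ (T.+1%:R)^-1)).
    by apply: ge_inf => //; exists A.
  have -> : (C / lam) `^ (T.+1%:R)^-1 * lam = (C * lam ^+ T) `^ (T.+1%:R)^-1.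
    have lamE : lam = (lam ^+ T.+1) `^ (T.+1%:R)^-1.
      by rewrite -powR_mulrn ?(ltW lam0)// -powRrM mulfV ?pnatr_eq0// powRr1// ltW.
    rewrite {2}lamE -powRM ?exprn_ge0 ?divr_ge0 ?(ltW lam0) ?(ltW C0)//.
    by rewrite exprS mulrA divfK// gt_eqF.
  rewrite ge0_ler_powR ?nnegrE ?(is_norm_ge0 _ hnormm)//.
  by rewrite mulr_ge0 ?exprn_ge0 ?(ltW lam0) ?(ltW C0).
near=> T.
have T0 : (0 < T)%N by near: T; exact: nbhs_infty_gt.
rewrite ltr_distlC; apply/andP; split.
  apply: lt_le_trans (lo _ T0); near: T; apply: (cvgr_gt rho lower).
  by rewrite ltrBlDr ltrDl.
apply: (le_lt_trans (up _ T0)); near: T; apply: (cvgr_lt lam upper).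
by rewrite ltrD2l ltr_pdivrMr// ltr_pMr// ltr1n.
Unshelve. all: by end_near. Qed.
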